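(* Let $X$ be a fibrewise $H$-space over a topological space $B$, with fibrewise multiplication $\mu:X\times_B X\to X$. Then $X$ admits a fibrewise division if and only if the fibrewise shearing map $sh=(pr_1,\mu):X\times_B X\to X\times_B X$ has a fibrewise pointed homotopy right inverse, i.e. there is a fibrewise pointed map $\psi:X\times_B X\to X\times_B X$ with $sh\circ\psi\simeq^B_B id$.
   Context: Fix a topological space $B$ and let $I=[0,1]$. A fibrewise pointed space over $B$ is a space $X$ with continuous maps $p_X:X\to B$ and $s_X:B\to X$ such that $p_X\circ s_X=id_B$. A fibrewise pointed map $f:X\to Y$ is a continuous map with $p_Y\circ f=p_X$ and $f\circ s_X=s_Y$. Two fibrewise pointed maps $f,g:X\to Y$ are fibrewise pointed homotopic, $f\simeq^B_B g$, if there is a continuous $H:X\times I\to Y$ with $H(x,0)=f(x)$, $H(x,1)=g(x)$, $p_Y(H(x,t))=p_X(x)$ and $H(s_X(b),t)=s_Y(b)$ for all $x\in X$, $b\in B$, $t\in I$. The fibrewise product $X\times_B X=\{(x,y)\in X\times X:p_X(x)=p_X(y)\}$ is fibrewise pointed with section $b\mapsto(s_X(b),s_X(b))$; $pr_1,pr_2:X\times_B X\to X$ are its projections. A fibrewise $H$-space is a fibrewise pointed space $X$ with a fibrewise pointed map $\mu:X\times_B X\to X$ (fibrewise multiplication) such that $\mu\circ i_1\simeq^B_B id_X$ and $\mu\circ i_2\simeq^B_B id_X$, where $i_1=(id_X,s_X\circ p_X)$ and $i_2=(s_X\circ p_X,id_X)$. A fibrewise division on $X$ is a fibrewise pointed map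 $\delta:X\times_B X\to X$ such that $\mu\circ(pr_1,\delta)\simeq^B_B pr_2$. The fibrewise shearing map is $sh(x,y)=(x,\mu(x,y))$. *)

(* Defs.v *)
From HB Require Import structures.
From mathcomp Require Import all_boot all_order all_algebra.
From mathcomp Require Import all_classical all_reals all_analysis.
Import Order.TTheory GRing.Theory Num.Theory.
Import numFieldNormedType.Exports.

Set Implicit Arguments.
Unset Strict Implicit.
Unset Printing Implicit Defensive.

Local Open Scope classical_set_scope.
Local Open Scope ring_scope.

(* A [set_type] carries the subspace topology (subtype_topology.v). *)
Definition unitI (R : realType) : topologicalType :=
  set_type `[0 : R, 1].

Lemma unitI0_subproof (R : realType) : 0 \in `[0 : R, 1]%classic.
Proof. by rewrite inE /= in_itv /= lexx ler01. Qed.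

Lemma unitI1_subproof (R : realType) : 1 \in `[0 : R, 1]%classic.
Proof. by rewrite inE /= in_itv /= lexx ler01. Qed.

Definition unitI0 (R : realType) : unitI R := exist _ 0 (unitI0_subproof R).
Definition unitI1 (R : realType) : unitI R := exist _ 1 (unitI1_subproof R).

Record fwPointed (B : topologicalType) := FwPointed {
  fw_sort :> topologicalType;
  fw_proj : fw_sort -> B;
  fw_sec : B -> fw_sort;
  fw_proj_continuous : continuous fw_proj;
  fw_sec_continuous : continuous fw_sec;
  fw_secK : forall b, fw_proj (fw_sec b) = b
}.

Record fwMap (B : topologicalType) (X Y : fwPointed B) := FwMap {
  fw_fun :> X -> Y;
  fw_fun_continuous : continuous fw_fun;
  fw_fun_proj : forall x, fw_proj (fw_fun x) = fw_proj x;
  fw_fun_sec : forall b, fw_fun (fw_sec X b) = fw_sec Y b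
}.

Definition fwHomotopic (R : realType) (B : topologicalType)
    (X Y : fwPointed B) (f g : fwMap X Y) : Prop :=
  exists H : X * unitI R -> Y,
    [/\ continuous H,
        forall x, H (x, unitI0 R) = f x,
        forall x, H (x, unitI1 R) = g x,
        forall x t, fw_proj (H (x, t)) = fw_proj x &
        forall b t, H (fw_sec X b, t) = fw_sec Y b].

Lemma fwid_continuous (B : topologicalType) (X : fwPointed B) :
  continuous (fun x : X => x).
Proof. by move=> x; exact: cvg_id. Qed.

Definition fwid (B : topologicalType) (X : fwPointed B) : fwMap X X :=
  FwMap (@fwid_continuous B X) (fun=> erefl) (fun=> erefl).

Section Comp.
Context (B : topologicalType) (X Y Z : fwPointed B).
Context (g : fwMap Y Z) (f : fwMap X Y).

Lemma fwcomp_continuous : continuous (fun x => g (f x)).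
Proof.
by move=> x; apply: continuous_comp; exact: fw_fun_continuous.
Qed.

Lemma fwcomp_proj x : fw_proj (g (f x)) = fw_proj x.
Proof. by rewrite !fw_fun_proj. Qed.

Lemma fwcomp_sec b : g (f (fw_sec X b)) = fw_sec Z b.
Proof. by rewrite !fw_fun_sec. Qed.

Definition fwcomp : fwMap X Z := FwMap fwcomp_continuous fwcomp_proj fwcomp_sec.

End Comp.

Section Retract.
Context (B : topologicalType) (X : fwPointed B).

Lemma fwsp_continuous : continuous (fun x : X => fw_sec X (fw_proj x)).
Proof.
move=> x; apply: continuous_comp; first exact: fw_proj_continuous.
exact: fw_sec_continuous.
Qed.

Lemma fwsp_proj (x : X) : fw_proj (fw_sec X (fw_proj x)) = fw_proj x.
Proof. exact: fw_secK. Qed.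

Lemma fwsp_sec b : fw_sec X (fw_proj (fw_sec X b)) = fw_sec X b.
Proof. by rewrite fw_secK. Qed.

(* The composite s_X \o p_X. *)
Definition fwsp : fwMap X X := FwMap fwsp_continuous fwsp_proj fwsp_sec.

End Retract.

Section Product.
Context (B : topologicalType) (X : fwPointed B).

Definition fwprod_sort : topologicalType :=
  set_type [set z : X * X | fw_proj z.1 = fw_proj z.2].

Definition fwprod_mk (x y : X) (xy : fw_proj x = fw_proj y) : fwprod_sort :=
  exist _ (x, y) (mem_set xy).

Definition fwprod_proj (z : fwprod_sort) : B := fw_proj (set_val z).1.

Definition fwprod_sec (b : B) : fwprod_sort :=
  fwprod_mk (erefl (fw_proj (fw_sec X b))).

Lemma fwprod_val1_continuous :
  continuous (fun z : fwprod_sort => (set_val z).1).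
Proof.
move=> z; apply: (@continuous_comp _ _ _ set_val fst).
  exact: initial_continuous.
exact: cvg_fst.
Qed.

Lemma fwprod_val2_continuous :
  continuous (fun z : fwprod_sort => (set_val z).2).
Proof.
move=> z; apply: (@continuous_comp _ _ _ set_val snd).
  exact: initial_continuous.
exact: cvg_snd.
Qed.

Lemma fwprod_mk_continuous (T : topologicalType) (f g : T -> X)
    (fg : forall t, fw_proj (f t) = fw_proj (g t)) :
  continuous f -> continuous g -> continuous (fun t => fwprod_mk (fg t)).
Proof.
move=> cf cg; apply: continuous_comp_initial => t.
by apply: cvg_pair; [exact: cf|exact: cg].
Qed.

Lemma fwprod_proj_continuous : continuous fwprod_proj.
Proof.
move=> z; apply: (@continuous_comp _ _ _ (fun z : fwprod_sort => (set_val z).1)).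
  exact: fwprod_val1_continuous.
exact: fw_proj_continuous.
Qed.

Lemma fwprod_sec_continuous : continuous fwprod_sec.
Proof. by apply: fwprod_mk_continuous; exact: fw_sec_continuous. Qed.

Lemma fwprod_secK b : fwprod_proj (fwprod_sec b) = b.
Proof. exact: fw_secK. Qed.

Definition fwprod : fwPointed B :=
  FwPointed fwprod_proj_continuous fwprod_sec_continuous fwprod_secK.

Definition fwpr1_fun (z : fwprod) : X := (set_val z).1.
Definition fwpr2_fun (z : fwprod) : X := (set_val z).2.

Lemma fwpr2_proj (z : fwprod) : fw_proj (fwpr2_fun z) = fw_proj z.
Proof. by case: z => z zP; exact: esym (set_mem zP). Qed.

Definition fwpr1 : fwMap fwprod X :=
  @FwMap B fwprod X fwpr1_fun fwprod_val1_continuous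
    (fun=> erefl) (fun=> erefl).

Definition fwpr2 : fwMap fwprod X :=
  @FwMap B fwprod X fwpr2_fun fwprod_val2_continuous
    fwpr2_proj (fun=> erefl).

Section Pair.
Context (Z : fwPointed B) (f g : fwMap Z X).

Lemma fwpair_over z : fw_proj (f z) = fw_proj (g z).
Proof. by rewrite !fw_fun_proj. Qed.

Definition fwpair_fun (z : Z) : fwprod := fwprod_mk (fwpair_over z).

Lemma fwpair_continuous : continuous fwpair_fun.
Proof. by apply: fwprod_mk_continuous; exact: fw_fun_continuous. Qed.

Lemma fwpair_proj z : fw_proj (fwpair_fun z) = fw_proj z.
Proof. exact: fw_fun_proj. Qed.

Lemma fwpair_sec b : fwpair_fun (fw_sec Z b) = fw_sec fwprod b.
Proof. by apply: val_inj; rewrite /= !fw_fun_sec. Qed.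

(* The map (f, g) into the fibrewise product. *)
Definition fwpair : fwMap Z fwprod :=
  FwMap fwpair_continuous fwpair_proj fwpair_sec.

End Pair.
End Product.

Arguments fwpr1 {B} X.
Arguments fwpr2 {B} X.

Record fwHSpace (R : realType) (B : topologicalType) := FwHSpace {
  fwH_sort :> fwPointed B;
  fwH_mul : fwMap (fwprod fwH_sort) fwH_sort;
  fwH_mul1 : fwHomotopic R
    (fwcomp fwH_mul (fwpair (fwid fwH_sort) (fwsp fwH_sort)))
    (fwid fwH_sort);
  fwH_mul2 : fwHomotopic R
    (fwcomp fwH_mul (fwpair (fwsp fwH_sort) (fwid fwH_sort)))
    (fwid fwH_sort)
}.

Definition fwDivision (R : realType) (B : topologicalType)
    (X : fwHSpace R B) (delta : fwMap (fwprod X) X) : Prop :=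
  fwHomotopic R (fwcomp (fwH_mul X) (fwpair (fwpr1 X) delta)) (fwpr2 X).

Definition fwShear (R : realType) (B : topologicalType) (X : fwHSpace R B) :
  fwMap (fwprod X) (fwprod X) := fwpair (fwpr1 X) (fwH_mul X).

(* Main.v *)
Require Import Defs.
From mathcomp Require Import all_boot all_order all_algebra.
From mathcomp Require Import all_classical all_reals all_analysis.
From mathcomp Require Import lra.
Import Order.TTheory GRing.Theory Num.Theory.
Import numFieldNormedType.Exports.

(** The components of [sh \o psi] are [psi_1] and [mu \o (psi_1, psi_2)], so a
    homotopy from [sh \o psi] to the identity consists of homotopies
    [psi_1 ~ pr_1] and [mu \o (psi_1, psi_2) ~ pr_2].

    If [delta] is a division, then [psi = (pr_1, delta)] is a right inverse:
    the first homotopy is constant and the second is the division property.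
    Conversely, [delta = psi_2] is a division, because the first homotopy
    allows replacing [psi_1] by [pr_1]:
    [mu \o (pr_1, psi_2) ~ mu \o (psi_1, psi_2) ~ pr_2].

    What this needs of fibrewise pointed homotopy is that it is an equivalence
    relation ([fwHomotopic_eq], [fwHomotopic_sym], [fwHomotopic_trans]),
    preserved by postcomposition ([fwHomotopic_compl]) and by pairing
    ([fwHomotopic_pair]).  Only transitivity takes work, since two homotopies
    have to be glued continuously along the middle of the interval. *)

Set Implicit Arguments.
Unset Strict Implicit.
Unset Printing Implicit Defensive.

Local Open Scope classical_set_scope.
Local Open Scope ring_scope.

Section Clamp.
Context (R : realType).

Lemma clampI_subproof (r : R) : Num.max 0 (Num.min 1 r) \in `[0 : R, 1]%classic.
Proof.
by rewrite inE /= in_itv /= le_max lexx ge_max ler01 ge_min lexx.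
Qed.

(** The retraction of the line onto the unit interval: composing with it turns
    any continuous real function into a reparametrization of homotopies. *)
Definition clampI (r : R) : unitI R :=
  exist _ (Num.max 0 (Num.min 1 r)) (clampI_subproof r).

Lemma clampI_continuous : continuous clampI.
Proof.
apply: continuous_comp_initial => r.
apply: (@continuous_max R R (cst 0) (Num.min 1) r); first exact: cvg_cst.
by apply: (@continuous_min R R (cst 1) id r); [exact: cvg_cst|exact: cvg_id].
Qed.

Lemma clampI0 (r : R) : r <= 0 -> clampI r = unitI0 R.
Proof.
move=> r0; apply: val_inj => /=.
by rewrite (min_idPr _) ?(max_idPl _) // (le_trans r0) ?ler01.
Qed.

Lemma clampI1 (r : R) : 1 <= r -> clampI r = unitI1 R.
Proof.
by move=> r1; apply: val_inj => /=; rewrite (min_idPl _) ?(max_idPr _) ?ler01.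
Qed.

Lemma unitI_val_snd_continuous (T : topologicalType) :
  continuous (fun xt : T * unitI R => set_val xt.2 : R).
Proof.
move=> xt; apply: (@continuous_comp _ _ _ snd (fun t : unitI R => set_val t : R)).
  exact: cvg_snd.
exact: initial_continuous.
Qed.

Lemma reparam_continuous (T U : topologicalType) (H : T * unitI R -> U)
    (phi : R -> R) : continuous H -> continuous phi ->
  continuous (fun xt : T * unitI R => H (xt.1, clampI (phi (set_val xt.2)))).
Proof.
move=> cH cphi.
have ct : continuous (fun xt : T * unitI R => clampI (phi (set_val xt.2))).
  move=> xt; apply: (@continuous_comp _ _ _
    (fun xt : T * unitI R => phi (set_val xt.2)) clampI);
    last exact: clampI_continuous.
  apply: (@continuous_comp _ _ _ (fun xt : T * unitI R => set_val xt.2 : R) phi);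
    last exact: cphi.
  exact: unitI_val_snd_continuous.
move=> xt; apply: (@continuous_comp _ _ _
  (fun xt : T * unitI R => (xt.1, clampI (phi (set_val xt.2)))) H); last exact: cH.
apply: (@cvg_pair _ _ _ (nbhs xt) (nbhs xt.1)
  (nbhs (clampI (phi (set_val xt.2))))); [exact: cvg_fst|exact: ct].
Qed.

End Clamp.

(** The pasting lemma for two closed sets, in the form of a function defined by
    comparing a continuous real function with a constant. *)
Lemma paste_le_continuous (R : realType) (T U : topologicalType) (h : T -> R)
    (c : R) (f g : T -> U) :
  continuous h -> continuous f -> continuous g ->
  (forall x, h x = c -> f x = g x) ->
  continuous (fun x => if h x <= c then f x else g x).
Proof.
move=> ch cf cg fg.
pose A := h @^-1` [set r | r <= c]; pose C := h @^-1` [set r | c <= r].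
have cA : closed A by apply: closed_comp => [x _|]; [exact: ch|exact: closed_le].
have cC : closed C by apply: closed_comp => [x _|]; [exact: ch|exact: closed_ge].
have AC : A `|` C = setT.
  apply/seteqP; split => // x _.
  by case: (leP (h x) c) => [|/ltW]; [left|right].
apply/continuous_subspace_setT; rewrite -AC; apply: withinU_continuous => //.
- apply: (@subspace_eq_continuous _ A U f _); last exact: continuous_subspaceT.
  by move=> x; rewrite inE /A /= /from_subspace => ->.
- apply: (@subspace_eq_continuous _ C U g _); last exact: continuous_subspaceT.
  move=> x; rewrite inE /C /= /from_subspace => cx; case: ifPn => // xc.
  by apply/esym/fg/eqP; rewrite eq_le xc cx.
Qed.

Section Homotopy.
Context (R : realType) (B : topologicalType).
Implicit Types X Y Z : fwPointed B.

Lemma fwHomotopic_eq X Y (f g : fwMap X Y) : f =1 g -> fwHomotopic R f g.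
Proof.
move=> fg; exists (fun xt => f xt.1); split => //= [xt|x t|b t].
- apply: (@continuous_comp _ _ _ fst f); first exact: cvg_fst.
  exact: fw_fun_continuous.
- exact: fw_fun_proj.
- exact: fw_fun_sec.
Qed.

Lemma fwHomotopic_sym X Y (f g : fwMap X Y) :
  fwHomotopic R f g -> fwHomotopic R g f.
Proof.
case=> H [cH H0 H1 Hp Hs].
exists (fun xt => H (xt.1, clampI (1 - set_val xt.2))); split => //=.
- apply: (reparam_continuous cH (phi := fun r => 1 - r)) => r.
  by apply: cvgB; [exact: cvg_cst|exact: cvg_id].
- by move=> x; rewrite clampI1 // subr0.
- by move=> x; rewrite clampI0 // subrr.
Qed.

(** Each homotopy is run at double speed on its half of the interval.  Thanks
    to the clamping both are defined on the whole interval, and at the middle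
    both give the value of [g]. *)
Lemma fwHomotopic_trans X Y (f g h : fwMap X Y) :
  fwHomotopic R f g -> fwHomotopic R g h -> fwHomotopic R f h.
Proof.
case=> H [cH H0 H1 Hp Hs] [K [cK K0 K1 Kp Ks]].
exists (fun xt => if set_val xt.2 <= 2^-1 :> R
  then H (xt.1, clampI (2 * set_val xt.2))
  else K (xt.1, clampI (2 * set_val xt.2 - 1))).
have c2 : continuous (fun r : R => 2 * r).
  by move=> r; apply: cvgM; [exact: cvg_cst|exact: cvg_id].
split => /=.
- apply: (@paste_le_continuous R (X * unitI R)%type Y
    (fun xt => set_val xt.2 : R)).
  + exact: unitI_val_snd_continuous.
  + exact: (reparam_continuous cH c2).
  + apply: (reparam_continuous cK (phi := fun r => 2 * r - 1)) => r.
    by apply: cvgB; [exact: c2|exact: cvg_cst].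
  + by move=> xt ->; rewrite clampI1 ?clampI0 ?H1 ?K0 // divff ?subrr.
- by move=> x; rewrite invr_ge0 ler0n clampI0 // mulr0.
- have -> : set_val (unitI1 R) = 1 by [].
  move=> x; rewrite ifF; last by apply/negbTE; rewrite -ltNge; lra.
  by rewrite clampI1 //; lra.
- by move=> x t; case: ifP.
- by move=> b t; case: ifP.
Qed.

Lemma fwHomotopic_compl X Y Z (k : fwMap Y Z) (f g : fwMap X Y) :
  fwHomotopic R f g -> fwHomotopic R (fwcomp k f) (fwcomp k g).
Proof.
case=> H [cH H0 H1 Hp Hs]; exists (k \o H); split => /=.
- by move=> xt; apply: continuous_comp; [exact: cH|exact: fw_fun_continuous].
- by move=> x; rewrite H0.
- by move=> x; rewrite H1.
- by move=> x t; rewrite fw_fun_proj.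
- by move=> b t; rewrite Hs fw_fun_sec.
Qed.

Lemma fwHomotopic_pair Z X (f f' g g' : fwMap Z X) :
  fwHomotopic R f f' -> fwHomotopic R g g' ->
  fwHomotopic R (fwpair f g) (fwpair f' g').
Proof.
case=> H [cH H0 H1 Hp Hs] [K [cK K0 K1 Kp Ks]].
(* The two homotopies pair because both stay over the projection to [B]. *)
have HK zt : fw_proj (H zt) = fw_proj (K zt) by case: zt => z t; rewrite Hp Kp.
exists (fun zt => fwprod_mk (HK zt)); split => //=.
- exact: fwprod_mk_continuous.
- by move=> z; apply: val_inj => /=; rewrite H0 K0.
- by move=> z; apply: val_inj => /=; rewrite H1 K1.
- by move=> b t; apply: val_inj => /=; rewrite Hs Ks.
Qed.

Lemma fwpair_eta Z X (f : fwMap Z (fwprod X)) :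
  fwpair (fwcomp (fwpr1 X) f) (fwcomp (fwpr2 X) f) =1 f.
Proof. by move=> z; apply: val_inj => /=; rewrite [RHS]surjective_pairing. Qed.

End Homotopy.

Theorem lemma5p3 (R : realType) (B : topologicalType) (X : fwHSpace R B) :
  (exists delta : fwMap (fwprod X) X, fwDivision delta) <->
  (exists psi : fwMap (fwprod X) (fwprod X),
     fwHomotopic R (fwcomp (fwShear X) psi) (fwid (fwprod X))).
Proof.
split=> [[delta div]|[psi inv]].
  exists (fwpair (fwpr1 X) delta).
  apply: (@fwHomotopic_trans _ _ _ _ _ (fwpair (fwpr1 X) (fwpr2 X))).
    apply: (@fwHomotopic_trans _ _ _ _ _ (fwpair (fwpr1 X)
      (fwcomp (fwH_mul X) (fwpair (fwpr1 X) delta)))).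
      by apply: fwHomotopic_eq => z; exact: val_inj.
    by apply: fwHomotopic_pair div; exact: fwHomotopic_eq.
  apply: fwHomotopic_eq => z; apply: val_inj => /=.
  by rewrite [RHS]surjective_pairing.
exists (fwcomp (fwpr2 X) psi).
have psi1 : fwHomotopic R (fwpr1 X) (fwcomp (fwpr1 X) psi).
  apply: fwHomotopic_sym.
  apply: fwHomotopic_trans (fwHomotopic_trans (fwHomotopic_compl (fwpr1 X) inv) _);
    exact: fwHomotopic_eq.
have mu_psi : fwHomotopic R (fwcomp (fwH_mul X) psi) (fwpr2 X).
  apply: fwHomotopic_trans (fwHomotopic_trans (fwHomotopic_compl (fwpr2 X) inv) _);
    exact: fwHomotopic_eq.
apply: fwHomotopic_trans mu_psi; apply: fwHomotopic_compl.
apply: (@fwHomotopic_trans _ _ _ _ _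
  (fwpair (fwcomp (fwpr1 X) psi) (fwcomp (fwpr2 X) psi))).
  by apply: fwHomotopic_pair psi1 _; exact: fwHomotopic_eq.
exact/fwHomotopic_eq/fwpair_eta.
Qed.
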